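(* Let $\tau$ be a cardinal with $\tau<\mathfrak{p}$. If $b_1\omega$ and $b_2\omega$ are compactifications of $\omega$ such that both remainders $b_1\omega\setminus\omega$ and $b_2\omega\setminus\omega$ are homeomorphic to $D^\tau$, then $b_1\omega$ and $b_2\omega$ are homeomorphic.
   Context: $\omega$ is the countably infinite discrete space. A compactification of $\omega$ is a compact Hausdorff space $b\omega$ containing $\omega$ (with its discrete topology) as a dense subspace; its remainder is the subspace $b\omega\setminus\omega$. $D=\{0,1\}$ is the two-point discrete space and $D^\tau$ carries the product topology. Two compactifications are called homeomorphic if they are homeomorphic as topological spaces. For sets $A,B\subseteq\omega$, $A\subseteq^* B$ means that $A\setminus B$ is finite. A family $\mathcal{F}$ of subsets of $\omega$ has the strong finite intersection property (sfip) if every nonempty finite subfamily has infinite intersection. A pseudointersection of $\mathcal{F}$ is an infinite set $H\subseteq\omega$ with $H\subseteq^* F$ for all $F\in\mathcal{F}$. The cardinal $\mathfrak{p}$ is the minimal cardinality of a family of subsets of $\omega$ that has sfip but has no (infinite) pseudointersection. *)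

(* Defs.v *)
From mathcomp Require Import all_boot.
From mathcomp Require Import all_classical topology.

Set Implicit Arguments.
Unset Strict Implicit.
Unset Printing Implicit Defensive.

Local Open Scope classical_set_scope.
Local Open Scope card_scope.

Definition homeomorphic (X Y : topologicalType) : Prop :=
  exists (f : X -> Y) (g : Y -> X),
    [/\ cancel f g, cancel g f, continuous f & continuous g].

Definition topological_embedding (X Y : topologicalType) (f : X -> Y) : Prop :=
  injective f /\
  forall A : set X, open A <-> exists2 U : set Y, open U & f @^-1` U = A.

(* omega is nat, whose topology in the library is discrete; the copy of omega
   inside B is range e. *)
Definition compactification_of_omega (B : topologicalType) (e : nat -> B) :
    Prop :=
  [/\ compact [set: B], hausdorff_space B, topological_embedding e
    & dense (range e)].

(* The coercion of a set to a type carries the subspace topology. *)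
Definition remainder (B : topologicalType) (e : nat -> B) : topologicalType :=
  set_type (~` range e).

Definition cantor_cube (I : Type) : topologicalType :=
  prod_topology (fun _ : I => bool).

Definition almost_subset (A B : set nat) : Prop := finite_set (A `\` B).

Definition sfip (F : set (set nat)) : Prop :=
  forall G : set (set nat), G `<=` F -> finite_set G -> G !=set0 ->
    infinite_set (\bigcap_(A in G) A).

Definition pseudointersection (F : set (set nat)) (H : set nat) : Prop :=
  infinite_set H /\ forall A, F A -> almost_subset H A.

Definition sfip_without_pseudointersection (F : set (set nat)) : Prop :=
  sfip F /\ ~ exists H, pseudointersection F H.

(* Cardinals are represented by types of that cardinality. *)
Definition card_lt (I K : Type) : Prop :=
  [set: I] #<= [set: K] /\ ~ ([set: K] #<= [set: I]).

Definition is_pseudointersection_number (K : Type) : Prop :=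
  (exists2 F, sfip_without_pseudointersection F & [set: K] #= F) /\
  (forall F, sfip_without_pseudointersection F -> [set: K] #<= F).

(* Main.v *)
(** By normality, the coordinates of the remainder [D^tau] extend to a
    retraction [r] of the compactification onto [D^tau]. The topology is then
    determined by the sequence [s n := r n] in [D^tau], and density of omega
    says that [s] visits each nonempty basic clopen set infinitely often. Given
    two such sequences [s1] and [s2], it suffices to find a permutation [pi] of
    omega such that, for each coordinate [a], [s1 n a = s2 (pi n) a] for all but
    finitely many [n]. For fixed [n] the sets [{m | s2 m a = s1 n a}] have the
    strong finite intersection property, hence a pseudointersection [M n]; since
    [tau] is also below the bounding number, a single function [g] eventually
    dominates, for each coordinate [a], the bounds beyond which the elements of
    [M n] agree with [n] at [a]. A back-and-forth
    construction with pairs [(n, m)] such that [m \in M n] and [g n <= m], or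
    symmetrically, yields [pi]. *)
Require Import Defs.
From mathcomp Require Import all_boot.
From mathcomp Require Import all_classical topology.

Set Implicit Arguments.
Unset Strict Implicit.
Unset Printing Implicit Defensive.

Local Open Scope classical_set_scope.
Local Open Scope card_scope.

(** * Finite and infinite subsets of omega *)

Lemma finite_set_natP (A : set nat) :
  finite_set A <-> exists N, forall n, A n -> n < N.
Proof.
split=> [/finite_seqP[s ->]|[N AN]]; last first.
  exact: (sub_finite_set AN (finite_II N)).
exists (\max_(i <- s) i).+1 => n /= ns.
by rewrite ltnS (leq_bigmax_seq (F := id)).
Qed.

Lemma infinite_set_natP (A : set nat) :
  infinite_set A <-> forall N, exists2 n, N <= n & A n.
Proof.
split=> [Ainf N|Aunb /finite_set_natP[N AN]].
  apply: contrapT => none; apply/Ainf/finite_set_natP; exists N => n An.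
  by rewrite ltnNge; apply/negP => Nn; apply: none; exists n.
by have [n Nn /AN] := Aunb N; rewrite ltnNge Nn.
Qed.

Lemma finite_set_bounded (T : Type) (G : set T) (h : T -> nat) :
  finite_set G -> exists N, forall t, G t -> h t <= N.
Proof.
move=> /(finite_image h)/finite_set_natP[N GN].
by exists N => t Gt; apply/ltnW/GN; exists t.
Qed.

Lemma card_leTTP (T U : Type) :
  [set: T] #<= [set: U] <-> exists f : T -> U, injective f.
Proof.
split=> [/card_leP[f]|[f finj]].
  exists (set_val \o f \o to_setT) => x y /= /val_inj fxy.
  by have := @inj _ _ _ f _ _ (mem_setT _) (mem_setT _) fxy; case.
have /card_eqPle[_ /card_le_trans] : f @` [set: T] #= [set: T].
  by apply: inj_card_eq => x y _ _; exact: finj.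
by apply; exact: card_leT.
Qed.

(** * Pseudointersections and domination below the pseudointersection number *)

Definition indexed_sfip (T : Type) (A : T -> set nat) : Prop :=
  forall G : set T, finite_set G -> infinite_set (\bigcap_(t in G) A t).

Lemma indexed_sfip_range (T : Type) (A : T -> set nat) :
  indexed_sfip A -> sfip (range A).
Proof.
move=> Asf G GA Gfin [B0 GB0].
have [t0 _ _] := GA _ GB0.
have /choice[g gP] : forall B, exists t, G B -> A t = B.
  move=> B; have [GB|nGB] := pselect (G B); last by exists t0.
  by have [t _ <-] := GA _ GB; exists t.
apply: sub_infinite_set (Asf _ (finite_image g Gfin)) => n GAn B GB.
by rewrite -(gP _ GB); apply: GAn; exists B.
Qed.

(* The [n]-th element is taken from the intersection of the first [n] sets. *)
Lemma countable_pseudointersection (T : Type) (A : T -> set nat) :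
  countable [set: T] -> indexed_sfip A ->
  exists H, pseudointersection (range A) H.
Proof.
move=> /card_leTTP[c cinj] Asf.
have cfin k : finite_set [set t | c t < k].
  by apply: (finite_preimage _ (finite_II k)) => x y _ _; exact: cinj.
have /choice[h hP] : forall k, exists n, k <= n /\ forall t, c t < k -> A t n.
  move=> k; have /infinite_set_natP/(_ k)[n kn An] := Asf _ (cfin k).
  by exists n.
exists (range h); split=> [|_ [t _ <-]].
  apply/infinite_set_natP => N; exists (h N); first by have [] := hP N.
  by exists N.
apply: sub_finite_set (finite_image h (finite_II (c t).+1)).
move=> _ [[k _ <-] nA]; exists k => //=; rewrite ltnNge; apply/negP => ctk.
by apply: nA; have [_] := hP k; apply.
Qed.

(** Hilbert's hotel: a copy [i] of [nat] in [T] is squeezed onto its even places, and the odd ones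
    receive the new summand. *)
Lemma card_le_sum_nat (T : Type) :
  infinite_set [set: T] -> [set: T + nat] #<= [set: T].
Proof.
move=> /infiniteP/card_leTTP[i iinj]; apply/card_leTTP.
pose g t := if pselect (exists k, i k = t) is left ex
            then i (projT1 (cid ex)).*2 else t.
have gi k : g (i k) = i k.*2.
  rewrite /g; case: pselect => [ex|[]]; last by exists k.
  by case: (cid ex) => k' /= /iinj ->.
have gN t : ~ range i t -> g t = t.
  by move=> nit; rewrite /g; case: pselect => // -[k ikt]; case: nit; exists k.
have gE t : (exists2 k, t = i k & g t = i k.*2) \/ (~ range i t /\ g t = t).
  have [[k _ <-]|nit] := pselect (range i t); first by left; exists k.
  by right; split; last exact: gN.
exists (fun x => match x with inl t => g t | inr k => i k.*2.+1 end).
move=> [t|k] [t'|k'].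
- have [[k -> ->]|[nt ->]] := gE t; have [[k' -> ->]|[nt' ->]] := gE t'.
  + by move=> /iinj/double_inj ->.
  + by move=> e; case: nt'; rewrite -e; exists k.*2.
  + by move=> e; case: nt; rewrite e; exists k'.*2.
  + by move=> ->.
- have [[k -> ->]|[nt ->]] := gE t => e.
    by move/iinj/(congr1 odd): e; rewrite /= !odd_double.
  by case: nt; rewrite e; exists k'.*2.+1.
- have [[k' -> ->]|[nt ->]] := gE t' => e.
    by move/iinj/(congr1 odd): e; rewrite /= !odd_double.
  by case: nt; rewrite -e; exists k.*2.+1.
- by move=> /iinj[] /double_inj ->.
Qed.

(** The summand [nat] leaves room for countably many auxiliary conditions. It adds nothing to an
    infinite [tau]; for finite [tau] the index type is countable. *)
Lemma pseudointersection_of_card_lt (p : Type)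
    (hp : is_pseudointersection_number p) (tau : Type) (htau : card_lt tau p)
    (A : tau + nat -> set nat) :
  indexed_sfip A -> exists H, pseudointersection (range A) H.
Proof.
move=> Asf; have [taufin|tauinf] := pselect (finite_set [set: tau]).
  apply: countable_pseudointersection => //.
  have /card_leTTP[c cinj] := finite_set_countable taufin.
  rewrite /countable; apply/card_leTTP.
  exists (fun x => match x with inl t => (c t).*2 | inr k => k.*2.+1 end).
  move=> [t|k] [t'|k'] /=.
  - by move=> /double_inj/cinj ->.
  - by move=> /(congr1 odd); rewrite /= !odd_double.
  - by move=> /(congr1 odd); rewrite /= !odd_double.
  - by move=> [] /double_inj ->.
apply: contrapT => noH.
have /hp.2 pA : sfip_without_pseudointersection (range A).
  by split=> //; exact: indexed_sfip_range.
case: htau => _; apply; apply: card_le_trans pA _.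
by apply: card_le_trans (card_image_le _ _) (card_le_sum_nat tauinf).
Qed.

(* The sets [P (inr k)] force a pseudointersection to contain pairs with
   arbitrarily large first coordinate; as [F a] is monotone, the value at [k]
   may be read off such a pair with first coordinate at least [k]. *)
Lemma eventually_dominated (p : Type) (hp : is_pseudointersection_number p)
    (tau : Type) (htau : card_lt tau p) (f : tau -> nat -> nat) :
  exists g, forall a, exists N, forall k, N <= k -> f a k <= g k.
Proof.
pose F a n := \max_(i < n.+1) f a i.
have fF a k n : k <= n -> f a k <= F a n.
  rewrite -ltnS => kn.
  exact: (@leq_bigmax _ (fun i : 'I_n.+1 => f a i) (Ordinal kn)).
pose P x (u : nat * nat) : Prop :=
  match x with inl a => F a u.1 <= u.2 | inr k => k <= u.1 end.
have Psf : indexed_sfip (fun x => pickle @` P x).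
  move=> G Gfin; apply/infinite_set_natP => N.
  (* [n] is fixed first, since the bound [m] on second coordinates depends on it; indices of the
     other kind count as 0. *)
  have [n nP] := finite_set_bounded
    (fun x : tau + nat => if x is inr k then k else 0) Gfin.
  have [m mP] := finite_set_bounded
    (fun x : tau + nat => if x is inl a then F a n else 0) Gfin.
  pose h j := pickle (n, m + j).
  have hinj : injective h by move=> i j /(pcan_inj pickleK)[] /addnI.
  have /infinite_set_natP/(_ N)[i Ni [j _ hj]] : infinite_set (range h).
    apply/infiniteP.
    by have /card_eqPle[] := @inj_card_eq _ _ setT h (in2W hinj).
  exists i => // -[a|k] Gx; exists (n, m + j) => //=.
    by apply: leq_trans (leq_addr _ _); exact: (mP _ Gx).
  exact: (nP _ Gx).
have [H [Hinf Hsub]] := pseudointersection_of_card_lt hp htau Psf.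
have /choice[u uP] : forall k, exists u : nat * nat, k <= u.1 /\ H (pickle u).
  move=> k; have Hk := Hsub _ (ex_intro2 _ _ (inr k) I erefl).
  have /infinite_setN0[n [Hn nHk]] := infinite_setD Hinf Hk.
  have [[v kv vn]|nP] := pselect ((pickle @` P (inr k)) n).
    by exists v; rewrite vn.
  by case: nHk.
exists (fun k => (u k).2) => a.
have Ha := Hsub _ (ex_intro2 _ _ (inl a) I erefl).
have pinj : injective (@pickle (nat * nat)%type) := pcan_inj pickleK.
(* Only finitely many pairs coded in [H] violate the bound for [a]; [N] bounds their first
   coordinates, so [u k] is none of them once [k] exceeds [N]. *)
have [N NP] := finite_set_bounded fst (finite_preimage (in2W pinj) Ha).
exists N.+1 => k Nk; have [ku Hu] := uP k.
apply: leq_trans (fF _ _ _ ku) _; rewrite leqNgt; apply/negP => lt.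
suff /NP : (pickle @^-1` (H `\` pickle @` P (inl a))) (u k).
  by rewrite leqNgt (leq_trans Nk ku).
by split=> // -[v vP /pinj vu]; move: lt; rewrite ltnNge -vu vP.
Qed.

(** * A permutation matching two sequences in each coordinate almost everywhere *)

Lemma uniq_map_inj_in (T U : eqType) (f : T -> U) (s : seq T) :
  uniq (map f s) -> {in s &, injective f}.
Proof.
elim: s => //= x s IH /andP[xs us] y z; rewrite !in_cons.
move=> /predU1P[->|ys] /predU1P[->|zs] // e; last exact: IH.
  by case/negP: xs; rewrite e map_f.
by case/negP: xs; rewrite -e map_f.
Qed.

Lemma back_and_forth (R : nat -> nat -> Prop) :
    (forall n, infinite_set [set m | R n m]) ->
    (forall m, infinite_set [set n | R n m]) ->
  exists pi rho : nat -> nat,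
    [/\ cancel pi rho, cancel rho pi & forall n, R n (pi n)].
Proof.
move=> Rr Rl.
pose ok (l : seq (nat * nat)) := [/\ uniq (unzip1 l), uniq (unzip2 l)
  & forall x, x \in l -> R x.1 x.2].
have fresh (s : seq nat) (A : set nat) : infinite_set A ->
    exists2 n, A n & n \notin s.
  move=> Ainf.
  have /infinite_setN0[n [An /= /negP ns]] :=
    infinite_setD Ainf (finite_seq s).
  by exists n.
have add_dom k l : ok l -> exists l', [/\ ok l', {subset l <= l'}
    & k \in unzip1 l'].
  move=> okl; have [kl|kl] := boolP (k \in unzip1 l).
    by exists l; split=> // x.
  have [m Rkm ml] := fresh (unzip2 l) _ (Rr k).
  exists ((k, m) :: l); split.
  - case: okl => u1 u2 lR; split; rewrite /= ?kl ?ml //.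
    by move=> x; rewrite in_cons => /predU1P[->|/lR].
  - by move=> x xl; rewrite in_cons xl orbT.
  - by rewrite /= mem_head.
have add_ran k l : ok l -> exists l', [/\ ok l', {subset l <= l'}
    & k \in unzip2 l'].
  move=> okl; have [kl|kl] := boolP (k \in unzip2 l).
    by exists l; split=> // x.
  have [m Rmk ml] := fresh (unzip1 l) _ (Rl k).
  exists ((m, k) :: l); split.
  - case: okl => u1 u2 lR; split; rewrite /= ?kl ?ml //.
    by move=> x; rewrite in_cons => /predU1P[->|/lR].
  - by move=> x xl; rewrite in_cons xl orbT.
  - by rewrite /= mem_head.
(* One step treats [k] on both sides; the premise [ok] lets [S] be total, with [[::]] as junk
   value. *)
have /choice[S SP] : forall kl : nat * seq (nat * nat), exists l', ok kl.2 ->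
    [/\ ok l', {subset kl.2 <= l'}, kl.1 \in unzip1 l' & kl.1 \in unzip2 l'].
  case=> k l /=; have [okl|?] := pselect (ok l); last by exists [::].
  have [l1 [ok1 sub1 k1]] := add_dom k l okl.
  have [l2 [ok2 sub2 k2]] := add_ran k l1 ok1.
  exists l2 => _; split=> // [x /sub1/sub2|] //.
  by case/mapP: k1 => x /sub2 xl2 ->; exact: map_f.
pose L := fix L k := if k is j.+1 then S (j, L j) else [::].
have okL k : ok (L k) by elim: k => [|k /(SP (k, _))[]].
have LS k : [/\ ok (L k.+1), {subset L k <= L k.+1}, k \in unzip1 (L k.+1)
    & k \in unzip2 (L k.+1)] by exact: SP (k, L k) (okL k).
have Lmono i j : i <= j -> {subset L i <= L j}.
  elim: j => [|j IH]; first by rewrite leqn0 => /eqP -> x.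
  rewrite leq_eqVlt => /predU1P[-> x //|/IH sub x /sub].
  by have [_ + _ _] := LS j; apply.
have dom n : exists m, (n, m) \in L n.+1.
  by have [_ _ /mapP[[n' m] nmL /= nE] _] := LS n; exists m; rewrite {1}nE.
have ran m : exists n, (n, m) \in L m.+1.
  by have [_ _ _ /mapP[[n m'] nmL /= mE]] := LS m; exists n; rewrite {1}mE.
have funL i j n m m' : (n, m) \in L i -> (n, m') \in L j -> m = m'.
  move=> /(Lmono _ _ (leq_maxl i j)) nm /(Lmono _ _ (leq_maxr i j)) nm'.
  have [u1 _ _] := okL (maxn i j).
  by case: (uniq_map_inj_in u1 nm nm' erefl).
have funR i j n n' m : (n, m) \in L i -> (n', m) \in L j -> n = n'.
  move=> /(Lmono _ _ (leq_maxl i j)) nm /(Lmono _ _ (leq_maxr i j)) nm'.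
  have [_ u2 _] := okL (maxn i j).
  by case: (uniq_map_inj_in u2 nm nm' erefl).
have [pi piL] := choice dom; have [rho rhoL] := choice ran.
exists pi, rho; split=> [n|m|n].
- exact: funR (rhoL (pi n)) (piL n).
- exact: funL (piL (rho m)) (rhoL m).
- by have [_ _ /(_ _ (piL n))] := okL n.+1.
Qed.

(** The bound beyond which [M n] agrees with [y n] at [a] depends on [n] and [a]. Keeping only the
    elements of [M n] from [g n] on leaves one threshold on [n] per coordinate. *)
Lemma almost_agreeing_sets (p : Type) (hp : is_pseudointersection_number p)
    (tau : Type) (htau : card_lt tau p) (y s : nat -> tau -> bool) :
    (forall n (G : set tau), finite_set G ->
      infinite_set [set m | forall a, G a -> s m a = y n a]) ->
  exists E : nat -> set nat, (forall n, infinite_set (E n)) /\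
    forall a, exists N, forall n m, N <= n -> E n m -> s m a = y n a.
Proof.
move=> ysf.
have /choice[M MP] : forall n, exists H, infinite_set H /\ forall a, exists N,
    forall m, N <= m -> H m -> s m a = y n a.
  move=> n; pose A (x : tau + nat) : set nat :=
    if x is inl a then [set m | s m a = y n a] else setT.
  have Asf : indexed_sfip A.
    move=> G Gfin.
    have iGfin : finite_set (inl @^-1` G : set tau).
      by apply: finite_preimage Gfin => a b _ _ [].
    by apply: sub_infinite_set (ysf n _ iGfin) => m mG [a|k] //= /mG.
  have [H [Hinf Hsub]] := pseudointersection_of_card_lt hp htau Asf.
  exists H; split=> // a.
  have /finite_set_natP[N NP] := Hsub _ (ex_intro2 _ _ (inl a) I erefl).
  exists N => m Nm Hm; apply: contrapT => ne.
  by have := NP m (conj Hm ne); rewrite ltnNge Nm.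
have /choice[f fP] : forall a, exists f, forall n m, f n <= m -> M n m ->
    s m a = y n a.
  move=> a; have /choice[f fP] : forall n, exists N, forall m, N <= m ->
    M n m -> s m a = y n a by move=> n; have [_] := MP n.
  by exists f.
have [g gP] := eventually_dominated hp htau f.
exists (fun n => M n `&` [set m | g n <= m]); split=> [n|a].
  apply/infinite_set_natP => N.
  have /infinite_set_natP/(_ (maxn N (g n)))[m + Mm] := (MP n).1.
  by rewrite geq_max => /andP[Nm gm]; exists m.
have [N NP] := gP a; exists N => n m Nn [Mm gm].
by apply: (fP a) Mm; apply: leq_trans gm; exact: NP.
Qed.

Lemma almost_agreeing_bijection (p : Type) (hp : is_pseudointersection_number p)
    (tau : Type) (htau : card_lt tau p) (s1 s2 : nat -> tau -> bool) :
    (forall (y : tau -> bool) (G : set tau), finite_set G ->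
      infinite_set [set n | forall a, G a -> s1 n a = y a]) ->
    (forall (y : tau -> bool) (G : set tau), finite_set G ->
      infinite_set [set n | forall a, G a -> s2 n a = y a]) ->
  exists pi rho : nat -> nat, [/\ cancel pi rho, cancel rho pi &
    forall a, finite_set [set n | s1 n a <> s2 (pi n) a]].
Proof.
move=> s1d s2d.
have [E [Einf EP]] := almost_agreeing_sets hp htau (fun n => s2d (s1 n)).
have [E' [Einf' EP']] := almost_agreeing_sets hp htau (fun n => s1d (s2 n)).
have [||pi [rho [piK rhoK piE]]] :=
    @back_and_forth (fun n m => E n m \/ E' m n).
- by move=> n; apply: sub_infinite_set (Einf n) => m; left.
- by move=> m; apply: sub_infinite_set (Einf' m) => n; right.
exists pi, rho; split=> // a.
have [N NP] := EP a; have [N' NP'] := EP' a.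
(* Disagreement at [a] forces [n < N] or [pi n < N']; injectivity of [pi] makes the second case
   finite. *)
apply: (@sub_finite_set _ _ (`I_N `|` pi @^-1` `I_N')); last first.
  rewrite finite_setU; split; first exact: finite_II.
  by apply: finite_preimage (finite_II _) => i j _ _; exact: (can_inj piK).
move=> n /= ne; have [nN|Nn] := ltnP n N; first by left.
right; rewrite /= ltnNge; apply/negP => N'pi; apply: ne.
by case: (piE n) => [/(NP _ _ Nn) ->|/(NP' _ _ N'pi) ->].
Qed.

(** * Compactifications of omega and their remainders *)

Lemma open_omega (B : topologicalType) (e : nat -> B) (A : set nat) :
  compactification_of_omega e -> open (e @` A).
Proof.
move=> [_ T2 [einj etop] edense].
have en n : open [set e n].
  have [U Uop eU] := (etop [set n]).1 (discrete_open _).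
  have Un : U (e n) by have : (e @^-1` U) n by rewrite eU.
  suff -> : [set e n] = U by [].
  (* With a second point in [U], removing [e n] would leave a nonempty open set missing omega,
     against density. *)
  apply/seteqP; split=> [_ -> //|x Ux]; apply: contrapT => xn.
  have UnD : open (U `&` ~` [set e n]).
    apply: openI => //; rewrite openC.
    exact/accessible_closed_set1/hausdorff_accessible.
  have [z [[Uz zn] [k _ ekz]]] := edense _ (ex_intro _ x (conj Ux xn)) UnD.
  have : (e @^-1` U) k by rewrite /= ekz.
  by rewrite eU => kn; apply: zn; rewrite -ekz kn.
rewrite (_ : e @` A = \bigcup_(n in A) [set e n]); last first.
  by apply/seteqP; split=> x [n An] /= => [<-|->]; exists n.
by apply: bigcup_open => n _.
Qed.

Lemma open_coordinate (I : Type) (i : I) (A : set bool) :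
  open [set f : cantor_cube I | A (f i)].
Proof.
have projc : continuous (fun f : cantor_cube I => f i).
  exact: (@proj_continuous {classic I} (fun=> bool) i).
by apply: (continuousP _).1 => //; exact: discrete_open.
Qed.

(* By normality a closed-open partition of the remainder is separated by two
   disjoint open sets [U0], [U1]; points of omega are isolated, so those
   outside [U1] may be added to [U0]. *)
Lemma extend_bool (B : topologicalType) (e : nat -> B)
    (c : remainder e -> bool) :
    compactification_of_omega e -> continuous c ->
  exists c' : B -> bool, (forall b, open [set z | c' z = b]) /\
    forall w, c' (set_val w) = c w.
Proof.
move=> Be cc; have [Bcpt T2 _ _] := Be.
pose Z b := [set x | exists2 w : remainder e, set_val w = x & c w = b].
have Zc b : closed (Z b).
  have [O Oop OE] : open (c @^-1` [set ~~ b]).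
    by move/continuousP: cc; apply; exact: discrete_open.
  (* [O] cuts out the other piece on the remainder; its union with omega is open and complements
     [Z b]. *)
  have -> : Z b = ~` (range e `|` O).
    apply/seteqP; split=> [_ [w <- cw] /= [|Ow]|x /= /not_orP[nx Ox]].
    - by have := set_valP w.
    - have : (set_val @^-1` O) w by [].
      by rewrite OE /= cw => /eqP; case: b {OE cw}.
    - have xr : x \in ~` range e by rewrite inE.
      exists (SigSub xr) => //; apply: contrapT => /eqP cx; apply: Ox.
      have : (c @^-1` [set ~~ b]) (SigSub xr).
        by move: cx => /=; case: (c _); case: b {OE}.
      by rewrite -OE.
  by apply: open_closedC; apply: openU => //; exact: open_omega.
have Bnormal : normal_space B := compact_normal T2 Bcpt.
have [|C C1 CZ] := Bnormal (Z true) (Zc true) (~` Z false).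
  move=> x [w <- cw]; apply: open_nbhs_nbhs; split; first by rewrite openC.
  by move=> [w' /val_inj -> ]; rewrite cw.
exists (fun z => `[< C° z >]); split=> [b|w].
  case: b.
    rewrite (_ : [set z | _] = C°); first exact: open_interior.
    by apply/seteqP; split=> z /asboolP.
  (* A remainder point outside the interior of [C] lies in [Z false], hence off the closure of [C];
     other exceptions are isolated points. *)
  rewrite (_ : [set z | _] = ~` closure C `|` e @` [set n | ~ C° (e n)]).
    apply: openU; last exact: open_omega.
    by rewrite openC; exact: closed_closure.
  apply/seteqP; split=> z /=.
    move=> /asboolPn nCz; have [[n _ enz]|nz] := pselect (range e z).
      by right; exists n; rewrite /= enz.
    left=> /CZ; apply.
    have zr : z \in ~` range e by rewrite inE.
    exists (SigSub zr) => //; apply/negbTE/negP => cz; apply: nCz.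
    by apply: C1; exists (SigSub zr).
  case=> [ncl|[n nC <-]]; apply/asboolPn => //.
  by move=> /interior_subset/subset_closure.
case cw: (c w).
  by apply/asboolP; apply: C1; exists w.
apply/asboolPn => /interior_subset/subset_closure/CZ; apply.
by exists w.
Qed.

Lemma remainder_retraction (I : Type) (B : topologicalType) (e : nat -> B) :
    compactification_of_omega e ->
    homeomorphic (remainder e) (cantor_cube I) ->
  exists (r : B -> I -> bool) (q : (I -> bool) -> B),
    [/\ forall i b, open [set z | r z i = b],
        forall y, ~ range e (q y), forall y, r (q y) = y &
        forall x, ~ range e x -> q (r x) = x].
Proof.
move=> Be [h [g [hK gK hc gc]]].
have /choice[r rP] : forall i, exists c' : B -> bool,
    (forall b, open [set z | c' z = b]) /\ forall w, c' (set_val w) = h w i.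
  move=> i; apply: extend_bool => //; apply/continuousP => A _.
  by move/continuousP: hc => /(_ _ (open_coordinate i A)).
have rh w : r^~ (set_val w) = h w by apply/funext => i; rewrite (rP i).2.
exists (fun z i => r i z), (fun y => set_val (g y)); split=> [i|y|y|x nx].
- exact: (rP i).1.
- exact: (set_valP (g y)).
- by rewrite rh gK.
- have xr : x \in ~` range e by rewrite inE.
  by have -> : x = set_val (SigSub xr : remainder e); rewrite ?rh ?hK.
Qed.

(** Were the set finite, removing its points from the open set of points agreeing with [x] on [G]
    would leave a neighbourhood of [x] disjoint from omega. *)
Lemma coordinates_dense (I : Type) (B : topologicalType) (e : nat -> B)
    (r : B -> I -> bool) (x : B) (G : set I) :
    compactification_of_omega e -> (forall i b, open [set z | r z i = b]) ->
    ~ range e x -> finite_set G ->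
  infinite_set [set n | forall i, G i -> r (e n) i = r x i].
Proof.
move=> Be rop nx Gfin Afin; have [_ T2 _ edense] := Be.
set A := [set n | _] in Afin.
have : open (\bigcap_(i in G) [set z | r z i = r x i] `&` ~` (e @` A)).
  apply: openI; last first.
    rewrite openC; apply: (accessible_finite_set_closed.1 _) => //.
      exact: hausdorff_accessible.
    exact: finite_image.
  rewrite -[X in open X]setCK setC_bigcap openC.
  apply: (@closed_bigcup B {classic I}) => // i _.
  by rewrite closedC; exact: rop.
move=> Oop; have [|z [[zG zA] [n _ enz]]] := edense _ _ Oop.
  exists x; split=> // -[n _ enx]; apply: nx; by exists n.
by apply: zA; exists n => // i Gi; rewrite enz; exact: zG.
Qed.

(* A cluster point [z] of [F] at a point [x] of the remainder lies in the
   remainder and has the same coordinates as [F x]. *)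
Lemma continuous_of_coordinates (I : Type) (B1 B2 : topologicalType)
    (e1 : nat -> B1) (e2 : nat -> B2)
    (r1 : B1 -> I -> bool) (r2 : B2 -> I -> bool) (q2 : (I -> bool) -> B2)
    (F : B1 -> B2) (pi : nat -> nat) :
    compactification_of_omega e1 -> compactification_of_omega e2 ->
    (forall i b, open [set z | r1 z i = b]) ->
    (forall i b, open [set z | r2 z i = b]) ->
    (forall x, ~ range e2 x -> q2 (r2 x) = x) ->
    injective F -> (forall n, F (e1 n) = e2 (pi n)) ->
    (forall x, ~ range e1 x -> ~ range e2 (F x)) ->
    (forall x, ~ range e1 x -> r2 (F x) = r1 x) ->
    (forall i, finite_set [set n | r1 (e1 n) i <> r2 (e2 (pi n)) i]) ->
  continuous F.
Proof.
move=> Be1 Be2 r1op r2op q2K Finj Fe FN Fr Ffin x.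
have T1fin (A : set B1) : finite_set A -> open (~` A).
  move=> Afin; rewrite openC; apply: (accessible_finite_set_closed.1 _) => //.
  by apply: hausdorff_accessible; have [] := Be1.
have [[n _ <-]|nx] := pselect (range e1 x).
  have en : open_nbhs (e1 n) [set e1 n].
    by split=> //; have := open_omega [set n] Be1; rewrite image_set1.
  move=> A FA; apply: filterS (open_nbhs_nbhs en) => _ ->.
  exact: (nbhs_singleton FA).
have [B2cpt T2 _ _] := Be2.
(* By compactness of [B2], convergence follows once [F x] is the only cluster point. *)
have clF z : cluster (F @ x) z -> z = F x.
  move=> clz.
  have meets (U : set B1) (V : set B2) : open U -> U x -> open V -> V z ->
      exists2 u, U u & V (F u).
    move=> Uop Ux Vop Vz.
    have FU : (F @ x) (F @` U).
      by apply: filterS (open_nbhs_nbhs (conj Uop Ux)) => u Uu; exists u.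
    have [_ [[u Uu <-] VFu]] := clz _ _ FU (open_nbhs_nbhs (conj Vop Vz)).
    by exists u.
  have nz : ~ range e2 z.
    move=> [m _ emz].
    (* Here [z] is isolated, while [F] takes the value [z] at most once and not at [x], so that
       preimage can be removed from the neighbourhood. *)
    have [u uU Fuz] : exists2 u, (~` (F @^-1` [set z])) u & [set z] (F u).
      apply: meets => //.
      - apply: T1fin; apply: finite_preimage (finite_set1 z).
        by move=> u v _ _; exact: Finj.
      - by move=> /= Fxz; apply: (FN _ nx); exists m; rewrite // Fxz.
      - by have := open_omega [set m] Be2; rewrite image_set1 emz.
    by [].
  rewrite -(q2K _ nz) -(q2K _ (FN _ nx)); congr q2; apply/funext => i.
  rewrite Fr //; set bad := [set n | r1 (e1 n) i <> r2 (e2 (pi n)) i].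
  (* Away from the finitely many bad points, [u] and [F u] have the same coordinate [i]. *)
  have [u [u1 ubad] u2] : exists2 u,
      ([set w | r1 w i = r1 x i] `&` ~` (e1 @` bad)) u &
      [set w | r2 w i = r2 z i] (F u).
    apply: meets => //.
    - by apply: openI; [exact: r1op|apply: T1fin; exact: finite_image (Ffin i)].
    - by split=> // -[n _ enx]; apply: nx; exists n.
  rewrite -u2 -u1; have [[n _ enu]|nu] := pselect (range e1 u).
    apply: contrapT => ne; apply: ubad; exists n => //.
    by rewrite /bad /= -Fe enu => e; apply: ne.
  by rewrite Fr.
apply: (compact_cluster_set1 T2 B2cpt filterT) => //.
  exact: filterT.
apply/seteqP; split=> [z /clF ->//|_ ->].
have [z [_ clz]] : [set: B2] `&` cluster (F @ x) !=set0.
  by apply: B2cpt; exact: filterT.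
by rewrite -(clF z clz).
Qed.

(** * Assembly of the homeomorphism *)

Theorem theorem2 (p : Type) (hp : is_pseudointersection_number p)
  (tau : Type) (htau : card_lt tau p)
  (b1 b2 : topologicalType) (e1 : nat -> b1) (e2 : nat -> b2)
  (hb1 : compactification_of_omega e1) (hb2 : compactification_of_omega e2)
  (hr1 : homeomorphic (remainder e1) (cantor_cube tau))
  (hr2 : homeomorphic (remainder e2) (cantor_cube tau)) :
  homeomorphic b1 b2.
Proof.
have [r1 [q1 [r1op q1N q1K r1K]]] := remainder_retraction hb1 hr1.
have [r2 [q2 [r2op q2N q2K r2K]]] := remainder_retraction hb2 hr2.
have [||pi [rho [piK rhoK pifin]]] := almost_agreeing_bijection hp htau
    (s1 := fun n => r1 (e1 n)) (s2 := fun n => r2 (e2 n)).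
- move=> y G Gfin; rewrite -(q1K y).
  exact: (coordinates_dense hb1 r1op (q1N y) Gfin).
- move=> y G Gfin; rewrite -(q2K y).
  exact: (coordinates_dense hb2 r2op (q2N y) Gfin).
(* One gluing, by [s] on omega and through coordinates on the remainder, serves for the map and its
   inverse; injectivity of [e] makes it well defined. *)
have glue (B B' : topologicalType) (e : nat -> B) (e' : nat -> B')
    (r : B -> tau -> bool) (q' : (tau -> bool) -> B') (s : nat -> nat) :
    injective e -> exists F : B -> B', (forall n, F (e n) = e' (s n)) /\
      forall x, ~ range e x -> F x = q' (r x).
  move=> einj.
  have /choice[F FP] : forall x, exists y,
      (forall n, e n = x -> y = e' (s n)) /\ (~ range e x -> y = q' (r x)).
    move=> x; have [[n _ enx]|nx] := pselect (range e x).
      exists (e' (s n)); split=> [k ekx|[]]; last by exists n.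
      by rewrite -enx in ekx; rewrite (einj _ _ ekx).
    by exists (q' (r x)); split=> // n enx; case: nx; exists n.
  exists F; split=> [n|x]; last exact: (FP x).2.
  exact: (FP (e n)).1.
have [_ _ [e1inj _] _] := hb1; have [_ _ [e2inj _] _] := hb2.
have [F [Fe FN]] := glue _ _ e1 e2 r1 q2 pi e1inj.
have [K [Ke KN]] := glue _ _ e2 e1 r2 q1 rho e2inj.
have FK : cancel F K.
  move=> x; have [[n _ <-]|nx] := pselect (range e1 x).
    by rewrite Fe Ke piK.
  by rewrite FN // KN // q2K r1K.
have KF : cancel K F.
  move=> x; have [[n _ <-]|nx] := pselect (range e2 x).
    by rewrite Ke Fe rhoK.
  by rewrite KN // FN // q1K r2K.
exists F, K; split=> //.
  apply: (continuous_of_coordinates hb1 hb2 r1op r2op r2K (can_inj FK)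
    Fe) => //.
  - by move=> x nx; rewrite FN.
  - by move=> x nx; rewrite FN.
apply: (continuous_of_coordinates hb2 hb1 r2op r1op r1K (can_inj KF) Ke).
- by move=> x nx; rewrite KN.
- by move=> x nx; rewrite KN.
(* The exceptions for [rho] lie in the image under [pi] of those for [pi]. *)
- move=> a; apply: sub_finite_set (finite_image pi (pifin a)) => m /= ne.
  by exists (rho m); rewrite /= rhoK // => /esym.
Qed.
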